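(* Let $\mathcal{S}=\langle\mathbf{Fm},\vdash\rangle$ be a logic in which LNC fails. Then its left variable inclusion companion $\mathcal{S}^l$ is strongly paraconsistent. Moreover, if $\mathcal{S}$ is a Hilbert-style logic, then its restricted rules companion $\mathcal{S}^{re}$ is also strongly paraconsistent.
   Context: $\mathbf{Fm}$ is the formula algebra of a logical language (connectives of finite arity, including unary $\neg$ and binary $\land$) over a countably infinite set $V$ of variables, universe $\mathit{Fm}$. A logic is a pair $\langle\mathbf{Fm},\vdash\rangle$ with $\vdash\subseteq\mathcal{P}(\mathit{Fm})\times\mathit{Fm}$ reflexive, transitive and closed under substitutions. $\mathrm{var}(\varphi)$ is the set of variables of $\varphi$, $\mathrm{var}(\Gamma)=\bigcup_{\gamma\in\Gamma}\mathrm{var}(\gamma)$. Left variable inclusion companion $\mathcal{S}^l=\langle\mathbf{Fm},\vdash^l\rangle$: $\Gamma\vdash^l\varphi$ iff there is $\Gamma'\subseteq\Gamma$ with $\mathrm{var}(\Gamma')\subseteq\mathrm{var}(\varphi)$ and $\Gamma'\vdash\varphi$. A Hilbert-style logic is given by schematic sets of axioms and rules $\frac{\Gamma}{\alpha}$, with derivations as finite sequences in the usual way; its restricted rules companion $\mathcal{S}^{re}$ has the same axioms and only the rules $\frac{\Gamma}{\alpha}$ with $\mathrm{var}(\Gamma)\subseteq\mathrm{var}(\alpha)$. In a logic with consequence $\vdash'$: ECQ holds if $\{\alpha,\neg\alpha\}\vdash'\beta$ for all $\alpha,\beta$; LNC holds if $\vdash'\neg(\alpha\land\neg\alpha)$ for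 all $\alpha$; the logic is strongly paraconsistent if both ECQ and LNC fail. *)

(* Defs.v *)
From Stdlib Require Import List.
From mathcomp Require Import all_boot.
From mathcomp Require Import boolp classical_sets functions cardinality.
Set Implicit Arguments.
Unset Strict Implicit.
Unset Printing Implicit Defensive.
Local Open Scope classical_set_scope.

Record language := Language {
  conn : Type;
  arity : conn -> nat;
  cneg : conn;
  cconj : conn;
  arity_cneg : arity cneg = 1;
  arity_cconj : arity cconj = 2 }.

Inductive Fm (L : language) (V : Type) : Type :=
| Var (x : V)
| App (c : conn L) (args : {ffun 'I_(arity c) -> Fm L V}).
Arguments Var {L V} x.
Arguments App {L V} c args.

(* By [arity_cneg] and [arity_cconj], [cneg] is applied to the single argument
   of index 0, and [cconj] to exactly the arguments of indices 0 and 1. *)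
Definition fneg (L : language) (V : Type) (f : Fm L V) : Fm L V :=
  App (cneg L) [ffun=> f].

Definition fconj (L : language) (V : Type) (f g : Fm L V) : Fm L V :=
  App (cconj L) [ffun i => if val i == 0 then f else g].

Fixpoint var (L : language) (V : Type) (f : Fm L V) : set V :=
  match f with
  | Var x => [set x]
  | App _ args => \bigcup_i var (args i)
  end.

Definition vars (L : language) (V : Type) (G : set (Fm L V)) : set V :=
  \bigcup_(g in G) var g.

(* Substitutions are the endomorphisms of the formula algebra, which is freely
   generated by [V]: each is given by its values on the variables. *)
Fixpoint subst (L : language) (V : Type) (s : V -> Fm L V) (f : Fm L V) :
    Fm L V :=
  match f with
  | Var x => s x
  | App c args => App c [ffun i => subst s (args i)]
  end.

Lemma Fm_nested_ind (L : language) (V : Type) (P : Fm L V -> Prop) :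
  (forall x, P (Var x)) ->
  (forall c (args : {ffun 'I_(arity c) -> Fm L V}),
     (forall i, P (args i)) -> P (App c args)) ->
  forall f, P f.
Proof.
move=> PV PA; fix IH 1 => -[x|c args]; first exact: PV.
by apply: PA => i; apply: IH.
Qed.

Lemma var_subst (L : language) (V : Type) (s : V -> Fm L V) (f : Fm L V) :
  var (subst s f) = \bigcup_(x in var f) var (s x).
Proof.
elim/Fm_nested_ind: f => [x|c args IH] /=; first by rewrite bigcup_set1.
apply/seteqP; split => y [].
  move=> i _; rewrite ffunE IH => -[x xi yx].
  by exists x => //; exists i.
move=> x [i _ xi] yx; exists i => //.
by rewrite ffunE IH; exists x.
Qed.

Record logic (L : language) (V : Type) := Logic {
  entails :> set (Fm L V) -> Fm L V -> Prop;
  entails_refl : forall G f, G f -> entails G f;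
  entails_trans : forall G D f,
    (forall d, D d -> entails G d) -> entails D f -> entails G f;
  entails_subst : forall s G f,
    entails G f -> entails (subst s @` G) (subst s f) }.

Definition ECQ (L : language) (V : Type) (S : logic L V) : Prop :=
  forall a b : Fm L V, S [set a; fneg a] b.

Definition LNC (L : language) (V : Type) (S : logic L V) : Prop :=
  forall a : Fm L V, S set0 (fneg (fconj a (fneg a))).

Definition strongly_paraconsistent (L : language) (V : Type) (S : logic L V) :
    Prop :=
  ~ ECQ S /\ ~ LNC S.

Definition left_entails (L : language) (V : Type) (S : logic L V)
    (G : set (Fm L V)) (f : Fm L V) : Prop :=
  exists G', [/\ G' `<=` G, vars G' `<=` var f & S G' f].

Lemma vars_subst (L : language) (V : Type) (s : V -> Fm L V)
    (G : set (Fm L V)) (f : Fm L V) :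
  vars G `<=` var f -> vars (subst s @` G) `<=` var (subst s f).
Proof.
move=> Gf y [_ [g Gg <-]]; rewrite !var_subst => -[x xg yx].
by exists x => //; apply: Gf; exists g.
Qed.

Lemma left_refl (L : language) (V : Type) (S : logic L V) G f :
  G f -> left_entails S G f.
Proof.
move=> Gf; exists [set f]; split; first by move=> _ ->.
  by move=> x [_ ->].
exact: entails_refl.
Qed.

Lemma left_trans (L : language) (V : Type) (S : logic L V) G D f :
  (forall d, D d -> left_entails S G d) -> left_entails S D f ->
  left_entails S G f.
Proof.
move=> GD [D' [D'D D'f SD'f]].
exists [set g | G g /\ var g `<=` var f]; split; first by move=> g [].
  by move=> x [g [_ gf]]; apply: gf.
apply: entails_trans SD'f => d D'd.
have [G' [G'G G'd SG'd]] := GD _ (D'D _ D'd).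
apply: entails_trans SG'd => g G'g; apply: entails_refl; split; first exact: G'G.
by move=> x xg; apply: D'f; exists d => //; apply: G'd; exists g.
Qed.

Lemma left_subst (L : language) (V : Type) (S : logic L V) s G f :
  left_entails S G f -> left_entails S (subst s @` G) (subst s f).
Proof.
move=> [G' [G'G G'f SG'f]]; exists (subst s @` G'); split.
- exact: image_subset.
- exact: vars_subst.
- exact: entails_subst.
Qed.

Definition left_companion (L : language) (V : Type) (S : logic L V) :
    logic L V :=
  Logic (@left_refl L V S) (@left_trans L V S) (@left_subst L V S).

(* [axiom] and [rule] hold all the instances of the axiom and rule schemes;
   being schematic is expressed as closure under substitutions. *)
Record hilbert_system (L : language) (V : Type) := HilbertSystem {
  axiom : set (Fm L V);
  rule : set (Fm L V) -> Fm L V -> Prop;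
  axiom_subst : forall s a, axiom a -> axiom (subst s a);
  rule_subst : forall s D a, rule D a -> rule (subst s @` D) (subst s a) }.

Definition justified (L : language) (V : Type) (H : hilbert_system L V)
    (G : set (Fm L V)) (prev : seq (Fm L V)) (f : Fm L V) : Prop :=
  [\/ axiom H f, G f |
      exists D, rule H D f /\ forall d, D d -> List.In d prev].

Definition derivation (L : language) (V : Type) (H : hilbert_system L V)
    (G : set (Fm L V)) (p : seq (Fm L V)) : Prop :=
  forall p1 f p2, p = p1 ++ f :: p2 -> justified H G p1 f.

Definition derives (L : language) (V : Type) (H : hilbert_system L V)
    (G : set (Fm L V)) (f : Fm L V) : Prop :=
  exists p, derivation H G (rcons p f).

Lemma derivation_nil (L : language) (V : Type) (H : hilbert_system L V) G :
  derivation H G [::].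
Proof. by case. Qed.

Lemma derivation_rcons (L : language) (V : Type) (H : hilbert_system L V)
    G p f :
  derivation H G (rcons p f) <-> derivation H G p /\ justified H G p f.
Proof.
split=> [Hpf|[Hp Hf] p1 g p2].
  split=> [p1 g p2 pE|]; last by apply: (Hpf p f [::]); rewrite cats1.
  by apply: (Hpf p1 g (rcons p2 f)); rewrite pE -rcons_cons rcons_cat.
case/lastP: p2 => [|p2 h]; last first.
  by rewrite -rcons_cons -rcons_cat => /rcons_inj[/Hp Hg _].
by rewrite cats1 => /rcons_inj[<- <-].
Qed.

Lemma justified_weaken (L : language) (V : Type) (H : hilbert_system L V)
    G p q f :
  (forall g, List.In g p -> List.In g q) -> justified H G p f ->
  justified H G q f.
Proof.
move=> pq [Hf|Gf|[D [HD Dp]]]; [by constructor 1|by constructor 2|].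
by constructor 3; exists D; split=> // d /Dp /pq.
Qed.

Lemma derivation_cat (L : language) (V : Type) (H : hilbert_system L V) G p q :
  derivation H G p -> derivation H G q -> derivation H G (p ++ q).
Proof.
move=> Hp; elim/last_ind: q => [|q f IH]; first by rewrite cats0.
rewrite -rcons_cat !derivation_rcons => -[/IH Hpq Hf]; split=> //.
apply: justified_weaken Hf => g qg; apply/List.in_or_app; by right.
Qed.

Lemma In_rcons (T : Type) (p : seq T) (f g : T) :
  List.In g (rcons p f) <-> List.In g p \/ g = f.
Proof.
elim: p => [|h p IH] /=; first by split=> [[->|//]|[//|->]]; [right|left].
rewrite IH; tauto.
Qed.

Lemma hilbert_refl (L : language) (V : Type) (H : hilbert_system L V) G f :
  G f -> derives H G f.
Proof.
move=> Gf; exists [::]; apply/derivation_rcons; split; first exact: derivation_nil.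
by constructor 2.
Qed.

Lemma hilbert_trans (L : language) (V : Type) (H : hilbert_system L V) G D f :
  (forall d, D d -> derives H G d) -> derives H D f -> derives H G f.
Proof.
move=> GD [p Hpf].
have sim q : derivation H D q ->
    exists2 r, derivation H G r & forall g, List.In g q -> List.In g r.
  elim/last_ind: q => [_|q g IH]; first by exists [::] => //; exact: derivation_nil.
  move=> /derivation_rcons[/IH[r Hr qr] jg].
  have [t Ht [gt rt]] : exists2 t, derivation H G t &
      List.In g t /\ forall h, List.In h r -> List.In h t.
    case: jg => [ag|Dg|[E [HE Eq]]].
    - exists (rcons r g); last by split=> [|h rh]; apply/In_rcons; [right|left].
      by apply/derivation_rcons; split=> //; constructor 1.
    - have [t Ht] := GD _ Dg; exists (r ++ rcons t g); first exact: derivation_cat.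
      split=> [|h rh]; apply/List.in_or_app; last by left.
      by right; apply/In_rcons; right.
    - exists (rcons r g); last by split=> [|h rh]; apply/In_rcons; [right|left].
      apply/derivation_rcons; split=> //; constructor 3; exists E; split=> //.
      by move=> d /Eq /qr.
  by exists t => // h /In_rcons[/qr/rt|->].
have [r Hr pr] := sim _ Hpf.
have fr : List.In f r by apply/pr/In_rcons; right.
have [r1 [r2 rE]] := List.in_split _ _ fr.
exists r1; apply/derivation_rcons; split; last exact: (Hr r1 f r2 rE).
move=> q1 g q2 qE; apply: (Hr q1 g (q2 ++ f :: r2)).
by rewrite rE qE; exact: (esym (catA q1 (g :: q2) (f :: r2))).
Qed.

Lemma hilbert_subst (L : language) (V : Type) (H : hilbert_system L V) s G f :
  derives H G f -> derives H (subst s @` G) (subst s f).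
Proof.
move=> [p Hp]; exists [seq subst s g | g <- p]; rewrite -map_rcons.
elim/last_ind: (rcons p f) Hp => [_|q g IH]; first exact: derivation_nil.
rewrite map_rcons !derivation_rcons => -[/IH Hq jg]; split=> //.
case: jg => [ag|Gg|[D [HD Dq]]].
- by constructor 1; apply: axiom_subst.
- by constructor 2; exists g.
- constructor 3; exists (subst s @` D); split; first exact: rule_subst.
  by move=> _ [d Dd <-]; apply/List.in_map/Dq.
Qed.

Definition hilbert_logic (L : language) (V : Type) (H : hilbert_system L V) :
    logic L V :=
  Logic (@hilbert_refl L V H) (@hilbert_trans L V H) (@hilbert_subst L V H).

Definition presents (L : language) (V : Type) (H : hilbert_system L V)
    (S : logic L V) : Prop :=
  forall G f, S G f <-> hilbert_logic H G f.

Definition restricted_rule (L : language) (V : Type) (H : hilbert_system L V)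
    (D : set (Fm L V)) (a : Fm L V) : Prop :=
  rule H D a /\ vars D `<=` var a.

Lemma restricted_rule_subst (L : language) (V : Type) (H : hilbert_system L V)
    s D a :
  restricted_rule H D a -> restricted_rule H (subst s @` D) (subst s a).
Proof.
by move=> [HD Da]; split; [exact: rule_subst|exact: vars_subst].
Qed.

Definition restricted_companion (L : language) (V : Type)
    (H : hilbert_system L V) : hilbert_system L V :=
  HilbertSystem (@axiom_subst L V H) (@restricted_rule_subst L V H).

(* Main.v *)
(* A variable x that does not occur in a formula f splits {x, ~x} off from f:
   the only subset of {x, ~x} whose variables all lie in var f is the empty one,
   so {x, ~x} entails f in the left companion only if f is a theorem of S.
   Applied to an instance f of the law of non-contradiction that S does not
   prove, this refutes ECQ. A restricted rule is a consequence with variable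
   inclusion, so every restricted derivation is sound for the left companion,
   and both failures pass to the restricted companion. *)
Require Import Defs.
From mathcomp Require Import all_boot.
From mathcomp Require Import boolp classical_sets functions cardinality.
Local Open Scope classical_set_scope.
Local Open Scope card_scope.

(** Arities are finite, so each connective takes a finite union. *)
Lemma finite_var (L : language) (V : Type) (f : Fm L V) : finite_set (var f).
Proof.
elim/Fm_nested_ind: f => [x|c args IH] /=; first exact: finite_set1.
by apply: bigcup_finite => // i _; apply: IH.
Qed.

Lemma exists_fresh_var (L : language) (V : Type) (f : Fm L V) :
  infinite_set [set: V] -> exists x, ~ var f x.
Proof.
move=> Vinf; apply/existsNP => fT; apply: Vinf.
by apply: sub_finite_set (finite_var _ _ f) => x _; apply: fT.
Qed.

Lemma var_fneg (L : language) (V : Type) (f : Fm L V) : var (fneg f) = var f.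
Proof.
apply/seteqP; split => [x [i _]|x fx] /=; first by rewrite ffunE.
have lt0 : 0 < arity (cneg L) by rewrite arity_cneg.
by exists (Ordinal lt0) => //; rewrite ffunE.
Qed.

Lemma left_entails_theorem (L : language) (V : Type) (S : logic L V) f :
  left_entails S set0 f -> S set0 f.
Proof. by move=> [G' []]; rewrite subset0 => ->. Qed.

Lemma left_entails_fresh (L : language) (V : Type) (S : logic L V) x f :
  ~ var f x -> left_entails S [set Var x; fneg (Var x)] f -> S set0 f.
Proof.
move=> fx [G' [G'x G'f SG'f]]; suff <- : G' = set0 by [].
rewrite -subset0 => g G'g; apply: fx; apply: G'f; exists g => //.
by case: (G'x _ G'g) => ->; rewrite ?var_fneg.
Qed.

(** All premises occur in [p], so filtering [p] by [D] lists them as hypotheses; the rule is then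
    the last step. *)
Lemma rule_derives (L : language) (V : Type) (H : hilbert_system L V) D p f :
  rule H D f -> (forall d, D d -> List.In d p) -> derives H D f.
Proof.
move=> HDf Dp; exists (List.filter (fun d => `[< D d >]) p).
apply/derivation_rcons; split; last first.
  constructor 3; exists D; split=> // d Dd.
  by apply/List.filter_In; split; [exact: Dp|exact/asboolP].
move=> p1 g p2 pE; constructor 2; apply/asboolP.
have /List.filter_In[] // : List.In g (List.filter (fun d => `[< D d >]) p).
by rewrite pE; apply/List.in_or_app; right; left.
Qed.

Lemma restricted_left (L : language) (V : Type) (S : logic L V)
    (H : hilbert_system L V) G f :
  presents H S -> derives (restricted_companion H) G f -> left_entails S G f.
Proof.
move=> HS [p Hp].
(* Every entry is treated, not only the last, since a rule may use any earlier one. *)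
suff sound q : derivation (restricted_companion H) G q ->
    forall g, List.In g q -> left_entails S G g.
  by apply: sound Hp _ _; apply/In_rcons; right.
elim/last_ind: q => [_ g []|q g IH] /derivation_rcons[/IH Gq jg] h.
move=> /In_rcons[/Gq//|->].
case: jg => [ag|Gg|[D [[HDg Dg] Dq]]].
- exists set0; split=> [//|x [k []]|]; apply/HS.
  exists [::]; apply/derivation_rcons; split; first exact: derivation_nil.
  by constructor 1.
- exact: left_refl.
(* The restriction [Dg] lets [D] itself witness the left entailment of [g]. *)
- apply: (@Defs.left_trans _ _ _ _ D) => [d /Dq/Gq //|].
  by exists D; split=> //; apply/HS; apply: rule_derives _ _ _ _ _ _ HDg Dq.
Qed.

(** Taking any [S'] below the left companion covers both companions at once. *)
Lemma strongly_paraconsistent_sub_left (L : language) (V : Type)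
    (S S' : logic L V) :
  infinite_set [set: V] -> ~ LNC S ->
  (forall G f, S' G f -> left_entails S G f) -> strongly_paraconsistent S'.
Proof.
move=> Vinf S_LNC S'S; split; last first.
  by move=> S'_LNC; apply: S_LNC => a; apply/left_entails_theorem/S'S/S'_LNC.
move=> S'_ECQ; apply: S_LNC => a.
have [x fx] := exists_fresh_var _ _ (fneg (fconj a (fneg a))) Vinf.
exact: left_entails_fresh fx (S'S _ _ (S'_ECQ _ _)).
Qed.

Theorem theorem3p13 (L : language) (V : Type) (V_countable : [set: V] #= [set: nat])
    (S : logic L V) (S_LNC : ~ LNC S) :
  strongly_paraconsistent (left_companion S) /\
  forall H : hilbert_system L V, presents H S ->
    strongly_paraconsistent (hilbert_logic (restricted_companion H)).
Proof.
have Vinf : infinite_set [set: V].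
  by rewrite (eq_finite_set V_countable); exact: infinite_nat.
split=> [|H HS]; apply: (strongly_paraconsistent_sub_left _ _ S) => // G f.
exact: restricted_left.
Qed.
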